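(* Let $\mathcal M,\mathcal N$ be $\mathcal C$-actegories, $\mathbf S$ a monad on $\mathcal M$, $\mathbf T$ a monad on $\mathcal N$, $l^S$ and $l^T$ distributive laws between the respective $\mathcal C$-actions and $\mathbf S$, $\mathbf T$. Let $(K,\zeta^K):\mathcal M\to\mathcal N$ be a colax $\mathcal C$-equivariant functor and $(K,\alpha):\mathbf T\to\mathbf S$ a map of monads, and let $H^\alpha:\mathcal M^{\mathbf S}\to\mathcal N^{\mathbf T}$ be the induced functor $H^\alpha(M,\nu)=(KM,K(\nu)\circ\alpha_M)$. For $C\in\mathrm{Ob}\,\mathcal C$ put $G^{\mathcal M}=C\lozenge^{\mathcal M}\_$, $G^{\mathcal N}=C\lozenge^{\mathcal N}\_$, and let $\tilde G^{\mathcal M}:\mathcal M^{\mathbf S}\to\mathcal M^{\mathbf S}$, $\tilde G^{\mathcal N}:\mathcal N^{\mathbf T}\to\mathcal N^{\mathbf T}$ be their lifts, $\tilde G^{\mathcal M}(M,\nu)=(G^{\mathcal M}M,G^{\mathcal M}(\nu)\circ l^S_M)$ and $\tilde G^{\mathcal N}(N,\nu)=(G^{\mathcal N}N,G^{\mathcal N}(\nu)\circ l^T_N)$. The condition $$G^{\mathcal N}\alpha\circ l^TK\circ T\zeta^K=\zeta^KS\circ Kl^S\circ\alpha G^{\mathcal M}$$ (for all $C$) ensures a 2-cell (natural transformation) $H^\alpha\tilde G^{\mathcal M}\Rightarrow\tilde G^{\mathcal N}H^\alpha$.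
   Context: $\mathcal C$ is a fixed monoidal category with product $\otimes$, unit $\mathbf 1$, associativity isomorphisms $a_{X,Y,Z}:X\otimes(Y\otimes Z)\to(X\otimes Y)\otimes Z$ and unit isomorphisms $l_A:\mathbf 1\otimes A\to A$, $r_A:A\otimes\mathbf 1\to A$. A $\mathcal C$-actegory is a category $\mathcal N$ with a bifunctor $\lozenge:\mathcal C\times\mathcal N\to\mathcal N$ and natural isomorphisms $\Psi_{Q,Q',N}:(Q\otimes Q')\lozenge N\to Q\lozenge(Q'\lozenge N)$, $u_N:\mathbf 1\lozenge N\to N$ such that $\Psi_{Q,Q',Q''\lozenge N}\circ\Psi_{Q\otimes Q',Q'',N}\circ(a_{Q,Q',Q''}\lozenge N)=(Q\lozenge\Psi_{Q',Q'',N})\circ\Psi_{Q,Q'\otimes Q'',N}$, $u_{Q\lozenge N}\circ\Psi_{\mathbf 1,Q,N}=l_Q\lozenge N$, $(Q\lozenge u_N)\circ\Psi_{Q,\mathbf 1,N}=r_Q\lozenge N$. A colax $\mathcal C$-equivariant functor $(F,\zeta):\mathcal M\to\mathcal N$ is a functor $F$ with a binatural transformation $\zeta_{C,M}:F(C\lozenge M)\to C\lozenge F(M)$ with $u_{F(M)}\circ\zeta_{\mathbf 1,M}=F(u_M)$ and $\Psi_{A,B,F(M)}\circ\zeta_{A\otimes B,M}=(A\lozenge\zeta_{B,M})\circ\zeta_{A,B\lozenge M}\circ F(\Psi_{A,B,M})$. For fixed $C$, $\zeta^K$ is viewed as a natural transformation $KG^{\mathcal M}\Rightarrow G^{\mathcal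 N}K$. A distributive law between the $\mathcal C$-action on $\mathcal M$ and a monad $(S,\mu,\eta)$ on $\mathcal M$ is a binatural transformation $l_{C,M}:S(C\lozenge M)\to C\lozenge SM$ making $(S,l)$ colax $\mathcal C$-equivariant and satisfying $l_{C,M}\circ\mu_{C\lozenge M}=(C\lozenge\mu_M)\circ l_{C,SM}\circ S(l_{C,M})$ and $l_{C,M}\circ\eta_{C\lozenge M}=C\lozenge\eta_M$; for fixed $C$ it is viewed as $l:SG\Rightarrow GS$ (with $G=C\lozenge\_$) with components $l_M$. A map of monads $(K,\alpha):\mathbf T\to\mathbf S$ ($\mathbf S=(S,\mu^S,\eta^S)$ on $\mathcal M$, $\mathbf T=(T,\mu^T,\eta^T)$ on $\mathcal N$) is a functor $K:\mathcal M\to\mathcal N$ with a natural transformation $\alpha:TK\Rightarrow KS$ such that $\alpha\circ\mu^TK=K\mu^S\circ\alpha S\circ T\alpha$ and $\alpha\circ\eta^TK=K\eta^S$. $\mathcal M^{\mathbf S}$ is the Eilenberg–Moore category of $\mathbf S$-modules $(M,\nu:SM\to M)$, and similarly for $\mathcal N^{\mathbf T}$. *)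

(* Defs.v *)
(* Written for the standard library only.  Categories have Leibniz equality on
   homs; proof irrelevance is used to compare morphisms of Eilenberg-Moore
   categories. *)
From Stdlib Require Import ProofIrrelevance.

Set Implicit Arguments.
Unset Strict Implicit.
Unset Printing Implicit Defensive.

Declare Scope cat_scope.
Delimit Scope cat_scope with cat.
Open Scope cat_scope.

(** * Categories, functors, natural transformations *)

Record Category := {
  Ob :> Type;
  Hom : Ob -> Ob -> Type;
  idm : forall X, Hom X X;
  comp : forall X Y Z, Hom Y Z -> Hom X Y -> Hom X Z;
  comp_idl : forall X Y (f : Hom X Y), comp (idm Y) f = f;
  comp_idr : forall X Y (f : Hom X Y), comp f (idm X) = f;
  comp_assoc : forall X Y Z W (h : Hom Z W) (g : Hom Y Z) (f : Hom X Y),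
    comp h (comp g f) = comp (comp h g) f
}.
Arguments Hom {_} _ _.
Arguments idm {_} _.
Arguments comp {_ _ _ _} _ _.

Notation "g ∘ f" := (comp g f) (at level 40, left associativity) : cat_scope.

Definition is_iso (A : Category) (X Y : A) (f : Hom X Y) : Prop :=
  exists g : Hom Y X, g ∘ f = idm X /\ f ∘ g = idm Y.

Record Functor (A B : Category) := {
  fob :> A -> B;
  fmap : forall X Y : A, Hom X Y -> Hom (fob X) (fob Y);
  fmap_id : forall X : A, fmap (idm X) = idm (fob X);
  fmap_comp : forall (X Y Z : A) (g : Hom Y Z) (f : Hom X Y),
    fmap (g ∘ f) = fmap g ∘ fmap f
}.
Arguments fmap {_ _} _ {_ _} _.

Definition functor_id (A : Category) : Functor A A.
Proof.
  refine {| fob := fun X => X; fmap := fun X Y f => f |}; reflexivity.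
Defined.

Definition functor_comp (A B D : Category) (G : Functor B D) (F : Functor A B) :
  Functor A D.
Proof.
  refine {| fob := fun X => G (F X); fmap := fun X Y f => fmap G (fmap F f) |}.
  - intros X; rewrite !fmap_id; reflexivity.
  - intros X Y Z g f; rewrite !fmap_comp; reflexivity.
Defined.

Record NatTrans (A B : Category) (F G : Functor A B) := {
  nt :> forall X : A, Hom (F X) (G X);
  nt_natural : forall (X Y : A) (f : Hom X Y), nt Y ∘ fmap F f = fmap G f ∘ nt X
}.

Definition prod_cat (A B : Category) : Category.
Proof.
  refine {| Ob := A * B;
            Hom := fun X Y => (Hom (fst X) (fst Y) * Hom (snd X) (snd Y))%type;
            idm := fun X => (idm (fst X), idm (snd X));
            comp := fun X Y Z g f => (fst g ∘ fst f, snd g ∘ snd f) |}.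
  - intros X Y [f g]; simpl; rewrite !comp_idl; reflexivity.
  - intros X Y [f g]; simpl; rewrite !comp_idr; reflexivity.
  - intros X Y Z W h g f; simpl; rewrite !comp_assoc; reflexivity.
Defined.

Definition Bifunctor (A B D : Category) := Functor (prod_cat A B) D.

Definition bob (A B D : Category) (F : Bifunctor A B D) (X : A) (Y : B) : D :=
  fob F (X, Y).

Definition bmap (A B D : Category) (F : Bifunctor A B D) (X X' : A) (Y Y' : B)
    (f : Hom X X') (g : Hom Y Y') : Hom (bob F X Y) (bob F X' Y') :=
  @fmap _ _ F (X, Y) (X', Y') (f, g).

Definition bpartial (A B D : Category) (F : Bifunctor A B D) (X : A) :
  Functor B D.
Proof.
  refine {| fob := fun Y => bob F X Y; fmap := fun Y Y' g => bmap F (idm X) g |}.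
  - intros Y; exact (@fmap_id _ _ F (X, Y)).
  - intros Y Y' Y'' g f.
    transitivity (bmap F (idm X ∘ idm X) (g ∘ f)); [rewrite comp_idl; reflexivity |].
    exact (@fmap_comp _ _ F (X, Y) (X, Y') (X, Y'') (idm X, g) (idm X, f)).
Defined.

(** * Monoidal categories and actegories *)

Record MonoidalCategory := {
  mc_cat :> Category;
  tensor : Bifunctor mc_cat mc_cat mc_cat;
  munit : mc_cat;
  massoc : forall X Y Z : mc_cat,
    Hom (bob tensor X (bob tensor Y Z)) (bob tensor (bob tensor X Y) Z);
  mleft : forall X : mc_cat, Hom (bob tensor munit X) X;
  mright : forall X : mc_cat, Hom (bob tensor X munit) X;
  massoc_iso : forall X Y Z, is_iso (massoc X Y Z);
  mleft_iso : forall X, is_iso (mleft X);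
  mright_iso : forall X, is_iso (mright X);
  massoc_natural : forall (X X' Y Y' Z Z' : mc_cat)
      (f : Hom X X') (g : Hom Y Y') (h : Hom Z Z'),
    massoc X' Y' Z' ∘ bmap tensor f (bmap tensor g h)
    = bmap tensor (bmap tensor f g) h ∘ massoc X Y Z;
  mleft_natural : forall (X X' : mc_cat) (f : Hom X X'),
    mleft X' ∘ bmap tensor (idm munit) f = f ∘ mleft X;
  mright_natural : forall (X X' : mc_cat) (f : Hom X X'),
    mright X' ∘ bmap tensor f (idm munit) = f ∘ mright X;
  mpentagon : forall X Y Z W : mc_cat,
    massoc (bob tensor X Y) Z W ∘ massoc X Y (bob tensor Z W)
    = bmap tensor (massoc X Y Z) (idm W)
      ∘ massoc X (bob tensor Y Z) W
      ∘ bmap tensor (idm X) (massoc Y Z W);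
  mtriangle : forall X Y : mc_cat,
    bmap tensor (mright X) (idm Y) ∘ massoc X munit Y
    = bmap tensor (idm X) (mleft Y)
}.
Arguments tensor {_}.
Arguments munit {_}.
Arguments massoc {_} _ _ _.
Arguments mleft {_} _.
Arguments mright {_} _.

Notation "X ⊗ Y" := (bob tensor X Y) (at level 30, right associativity) : cat_scope.

Record Actegory (C : MonoidalCategory) := {
  ac_cat :> Category;
  act : Bifunctor C ac_cat ac_cat;
  act_assoc : forall (Q Q' : C) (N : ac_cat),
    Hom (bob act (Q ⊗ Q') N) (bob act Q (bob act Q' N));
  act_unit : forall N : ac_cat, Hom (bob act munit N) N;
  act_assoc_iso : forall Q Q' N, is_iso (act_assoc Q Q' N);
  act_unit_iso : forall N, is_iso (act_unit N);
  act_assoc_natural : forall (Q P Q' P' : C) (N L : ac_cat)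
      (f : Hom Q P) (g : Hom Q' P') (h : Hom N L),
    act_assoc P P' L ∘ bmap act (bmap tensor f g) h
    = bmap act f (bmap act g h) ∘ act_assoc Q Q' N;
  act_unit_natural : forall (N L : ac_cat) (h : Hom N L),
    act_unit L ∘ bmap act (idm munit) h = h ∘ act_unit N;
  act_pentagon : forall (Q Q' Q'' : C) (N : ac_cat),
    act_assoc Q Q' (bob act Q'' N) ∘ act_assoc (Q ⊗ Q') Q'' N
      ∘ bmap act (massoc Q Q' Q'') (idm N)
    = bmap act (idm Q) (act_assoc Q' Q'' N) ∘ act_assoc Q (Q' ⊗ Q'') N;
  act_unit_left : forall (Q : C) (N : ac_cat),
    act_unit (bob act Q N) ∘ act_assoc munit Q N = bmap act (mleft Q) (idm N);
  act_unit_right : forall (Q : C) (N : ac_cat),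
    bmap act (idm Q) (act_unit N) ∘ act_assoc Q munit N
    = bmap act (mright Q) (idm N)
}.
Arguments act {_ _}.
Arguments act_assoc {_ _} _ _ _.
Arguments act_unit {_ _} _.

Notation "Q ◊ N" := (bob act Q N) (at level 30, right associativity) : cat_scope.
Notation "f ◊m g" := (bmap act f g) (at level 30, right associativity) : cat_scope.

(* The endofunctor [Q ◊ _]. *)
Definition act_functor (C : MonoidalCategory) (N : Actegory C) (Q : C) :
  Functor N N := bpartial act Q.
Arguments act_functor {_} _ _.

(* A colax equivariant functor is a functor [F] together with an element of
   [Colax F]. *)
Record Colax (C : MonoidalCategory) (M N : Actegory C) (F : Functor M N) := {
  colax :> forall (Q : C) (X : M), Hom (F (Q ◊ X)) (Q ◊ F X);
  colax_natural : forall (Q Q' : C) (X X' : M) (f : Hom Q Q') (g : Hom X X'),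
    colax Q' X' ∘ fmap F (f ◊m g) = (f ◊m fmap F g) ∘ colax Q X;
  colax_unit : forall X : M,
    act_unit (F X) ∘ colax munit X = fmap F (act_unit X);
  colax_assoc : forall (A B : C) (X : M),
    act_assoc A B (F X) ∘ colax (A ⊗ B) X
    = (idm A ◊m colax B X) ∘ colax A (B ◊ X) ∘ fmap F (act_assoc A B X)
}.

(** * Monads, maps of monads, Eilenberg-Moore categories *)

Record Monad (A : Category) := {
  mfun :> Functor A A;
  mu : NatTrans (functor_comp mfun mfun) mfun;
  eta : NatTrans (functor_id A) mfun;
  mu_assoc : forall X : A, mu X ∘ fmap mfun (mu X) = mu X ∘ mu (mfun X);
  mu_eta_left : forall X : A, mu X ∘ eta (mfun X) = idm (mfun X);
  mu_eta_right : forall X : A, mu X ∘ fmap mfun (eta X) = idm (mfun X)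
}.
Arguments mu {_} _.
Arguments eta {_} _.

(* Only the transformation of a map of monads [(K, α) : T -> S]; [K] is a
   parameter. *)
Record MonadMap (A B : Category) (T : Monad B) (S : Monad A) (K : Functor A B) := {
  mm_nt :> NatTrans (functor_comp T K) (functor_comp K S);
  mm_mu : forall X : A,
    mm_nt X ∘ mu T (K X) = fmap K (mu S X) ∘ mm_nt (S X) ∘ fmap T (mm_nt X);
  mm_eta : forall X : A, mm_nt X ∘ eta T (K X) = fmap K (eta S X)
}.

Record Module (A : Category) (S : Monad A) := {
  carrier : A;
  structure : Hom (S carrier) carrier;
  module_mu : structure ∘ mu S carrier = structure ∘ fmap S structure;
  module_eta : structure ∘ eta S carrier = idm carrier
}.

Record ModuleMap (A : Category) (S : Monad A) (X Y : Module S) := {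
  underlying : Hom (carrier X) (carrier Y);
  underlying_linear :
    underlying ∘ structure X = structure Y ∘ fmap S underlying
}.

Lemma module_map_eq (A : Category) (S : Monad A) (X Y : Module S)
    (f g : ModuleMap X Y) : underlying f = underlying g -> f = g.
Proof.
  destruct f as [f hf], g as [g hg]; simpl; intros e; subst g.
  f_equal; apply proof_irrelevance.
Qed.

Definition EM (A : Category) (S : Monad A) : Category.
Proof.
  unshelve refine {|
    Ob := Module S;
    Hom := fun X Y => ModuleMap X Y;
    idm := fun X => {| underlying := idm (carrier X) |};
    comp := fun X Y Z g f => {| underlying := underlying g ∘ underlying f |} |}.
  - rewrite fmap_id, comp_idl, comp_idr; reflexivity.
  - rewrite fmap_comp, <- comp_assoc, underlying_linear, comp_assoc,
      underlying_linear, comp_assoc; reflexivity.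
  - intros X Y f; apply module_map_eq, comp_idl.
  - intros X Y f; apply module_map_eq, comp_idr.
  - intros X Y Z W h g f; apply module_map_eq, comp_assoc.
Defined.

Lemma lift_mu_aux (A : Category) (V V' W X Y Z : A)
    (n : Hom Y Z) (a : Hom X Y) (m : Hom W X) (tn : Hom V' X) (ta : Hom W V')
    (km ksn : Hom V Y) (a' : Hom V' V) :
  a ∘ m = km ∘ a' ∘ ta -> n ∘ km = n ∘ ksn -> a ∘ tn = ksn ∘ a' ->
  (n ∘ a) ∘ m = (n ∘ a) ∘ (tn ∘ ta).
Proof.
  intros d e h.
  rewrite <- !comp_assoc, d, !comp_assoc, e, <- (comp_assoc n a tn), h.
  rewrite !comp_assoc; reflexivity.
Qed.

Lemma lift_map_aux (A : Category) (X X' Y Y' Z Z' : A)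
    (n : Hom Y Z) (a : Hom X Y) (n' : Hom Y' Z') (a' : Hom X' Y')
    (f : Hom Z Z') (sf : Hom Y Y') (tf : Hom X X') :
  f ∘ n = n' ∘ sf -> a' ∘ tf = sf ∘ a -> f ∘ (n ∘ a) = (n' ∘ a') ∘ tf.
Proof.
  intros d e.
  rewrite comp_assoc, d, <- !comp_assoc, e; reflexivity.
Qed.

Definition EM_map_ob (A B : Category) (T : Monad B) (S : Monad A) (K : Functor A B)
    (alpha : MonadMap T S K) (X : Module S) : Module T.
Proof.
  unshelve refine {|
    carrier := K (carrier X);
    structure := fmap K (structure X) ∘ alpha (carrier X) |}.
  - rewrite fmap_comp.
    refine (lift_mu_aux (mm_mu alpha (carrier X)) _ (nt_natural alpha (structure X))).
    exact (eq_trans (eq_sym (fmap_comp K _ _))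
             (eq_trans (f_equal (@fmap _ _ K _ _) (module_mu X)) (fmap_comp K _ _))).
  - refine (eq_trans (eq_sym (comp_assoc _ _ _)) _).
    refine (eq_trans (f_equal (comp _) (mm_eta alpha (carrier X))) _).
    refine (eq_trans (eq_sym (fmap_comp K _ _)) _).
    exact (eq_trans (f_equal (@fmap _ _ K _ _) (module_eta X)) (fmap_id K _)).
Defined.

(* The functor [H^α : M^S -> N^T], [(X, ν) |-> (K X, K ν ∘ α_X)], [f |-> K f]. *)
Definition EM_map (A B : Category) (T : Monad B) (S : Monad A) (K : Functor A B)
    (alpha : MonadMap T S K) : Functor (EM S) (EM T).
Proof.
  unshelve refine (@Build_Functor (EM S) (EM T) (EM_map_ob alpha)
    (fun X Y f => @Build_ModuleMap _ T (EM_map_ob alpha X) (EM_map_ob alpha Y)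
       (fmap K (underlying f)) _) _ _).
  - refine (lift_map_aux _ (nt_natural alpha (underlying f))).
    exact (eq_trans (eq_sym (fmap_comp K _ _))
             (eq_trans (f_equal (@fmap _ _ K _ _) (underlying_linear f))
                (fmap_comp K _ _))).
  - intros X; apply module_map_eq; apply fmap_id.
  - intros X Y Z g f; apply module_map_eq; apply fmap_comp.
Defined.

(** * Distributive laws between an action and a monad *)

Record DistrLaw (C : MonoidalCategory) (M : Actegory C) (S : Monad M) := {
  dl_colax :> @Colax C M M S;
  dl_mu : forall (Q : C) (X : M),
    dl_colax Q X ∘ mu S (Q ◊ X)
    = (idm Q ◊m mu S X) ∘ dl_colax Q (S X) ∘ fmap S (dl_colax Q X);
  dl_eta : forall (Q : C) (X : M),
    dl_colax Q X ∘ eta S (Q ◊ X) = idm Q ◊m eta S X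
}.

Definition EM_lift_ob (C : MonoidalCategory) (M : Actegory C) (S : Monad M)
    (l : DistrLaw S) (Q : C) (X : Module S) : Module S.
Proof.
  unshelve refine {|
    carrier := act_functor M Q (carrier X);
    structure := fmap (act_functor M Q) (structure X) ∘ l Q (carrier X) |}.
  - rewrite fmap_comp.
    refine (lift_mu_aux (dl_mu l Q (carrier X)) _
              (colax_natural l (idm Q) (structure X))).
    exact (eq_trans (eq_sym (fmap_comp (act_functor M Q) _ _))
             (eq_trans (f_equal (@fmap _ _ (act_functor M Q) _ _) (module_mu X))
                (fmap_comp (act_functor M Q) _ _))).
  - refine (eq_trans (eq_sym (comp_assoc _ _ _)) _).
    refine (eq_trans (f_equal (comp _) (dl_eta l Q (carrier X))) _).
    refine (eq_trans (eq_sym (fmap_comp (act_functor M Q) _ _)) _).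
    exact (eq_trans (f_equal (@fmap _ _ (act_functor M Q) _ _) (module_eta X))
             (fmap_id (act_functor M Q) _)).
Defined.

(* The lift of [G = Q ◊ _] to [M^S], [(X, ν) |-> (G X, G ν ∘ l_X)],
   [f |-> G f]. *)
Definition EM_lift (C : MonoidalCategory) (M : Actegory C) (S : Monad M)
    (l : DistrLaw S) (Q : C) : Functor (EM S) (EM S).
Proof.
  unshelve refine (@Build_Functor (EM S) (EM S) (EM_lift_ob l Q)
    (fun X Y f => @Build_ModuleMap _ S (EM_lift_ob l Q X) (EM_lift_ob l Q Y)
       (fmap (act_functor M Q) (underlying f)) _) _ _).
  - refine (lift_map_aux _ (colax_natural l (idm Q) (underlying f))).
    exact (eq_trans (eq_sym (fmap_comp (act_functor M Q) _ _))
             (eq_trans (f_equal (@fmap _ _ (act_functor M Q) _ _)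
                          (underlying_linear f))
                (fmap_comp (act_functor M Q) _ _))).
  - intros X; apply module_map_eq; apply fmap_id.
  - intros X Y Z g f; apply module_map_eq; apply fmap_comp.
Defined.

(* Main.v *)
Require Import Defs.

(** The components of the 2-cell are those of [zetaK Q], so two things are to be
    seen: that each is a map of [T]-modules, and that they are natural.  Since
    maps of modules are equal when their underlying maps are, naturality is that
    of [zetaK] in its second variable.  For a module [(X, ν)], linearity is a
    pasting of two squares: naturality of [zetaK] moves [ν] from inside [K G] to
    inside [G K], and the compatibility condition at [X] exchanges the remaining
    structure maps [lS], [lT] and [alpha] ([colax_linear]). *)

(** With [G] for [Q ◊ _], [X] the carrier and [ν] the structure, both sides equal
    [G (K ν) ∘ zetaK Q (S X) ∘ K (lS Q X) ∘ alpha (G X)]: the left one by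
    naturality of [zetaK] at [ν], the right one by the compatibility condition
    at [X]. *)
Lemma colax_linear (C : MonoidalCategory) (M N : Actegory C)
    (S : Monad M) (T : Monad N) (lS : DistrLaw S) (lT : DistrLaw T)
    (K : Functor M N) (zetaK : Colax K) (alpha : MonadMap T S K)
    (Q : C) (X : Module S) :
  fmap (act_functor N Q) (alpha (carrier X)) ∘ lT Q (K (carrier X))
    ∘ fmap T (zetaK Q (carrier X))
  = zetaK Q (S (carrier X)) ∘ fmap K (lS Q (carrier X))
    ∘ alpha (act_functor M Q (carrier X)) ->
  zetaK Q (carrier X) ∘ structure (EM_map_ob alpha (EM_lift_ob lS Q X))
  = structure (EM_lift_ob lT Q (EM_map_ob alpha X))
    ∘ fmap T (zetaK Q (carrier X)).
Proof.
  intros compat.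
  set (GM := act_functor M Q) in *; set (GN := act_functor N Q) in *.
  pose (nu := structure X).
  change (zetaK Q (carrier X)
            ∘ (fmap K (fmap GM nu ∘ lS Q (carrier X)) ∘ alpha (GM (carrier X)))
          = (fmap GN (fmap K nu ∘ alpha (carrier X)) ∘ lT Q (K (carrier X)))
            ∘ fmap T (zetaK Q (carrier X))).
  transitivity (fmap GN (fmap K nu)
                  ∘ (zetaK Q (S (carrier X)) ∘ fmap K (lS Q (carrier X))
                       ∘ alpha (GM (carrier X)))).
  - pose proof (colax_natural zetaK (idm Q) nu
      : zetaK Q (carrier X) ∘ fmap K (fmap GM nu)
        = fmap GN (fmap K nu) ∘ zetaK Q (S (carrier X))) as nat.
    (* The objects [GM Y] and [Q ◊ Y] are only convertible, which blocks
       syntactic rewriting with [fmap_comp]. *)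
    refine (eq_trans (f_equal (fun h => _ ∘ (h ∘ _)) (fmap_comp K _ _)) _).
    refine (eq_trans (f_equal (comp _) (eq_sym (comp_assoc _ _ _))) _).
    refine (eq_trans (comp_assoc _ _ _) _).
    refine (eq_trans (f_equal (fun h => h ∘ _) nat) _).
    refine (eq_trans (eq_sym (comp_assoc _ _ _)) _).
    exact (f_equal (comp _) (comp_assoc _ _ _)).
  - refine (eq_trans (f_equal (comp _) (eq_sym compat)) _).
    refine (eq_trans (comp_assoc _ _ _) _).
    refine (f_equal (fun h => h ∘ _) _).
    refine (eq_trans (comp_assoc _ _ _) _).
    exact (f_equal (fun h => h ∘ _) (eq_sym (fmap_comp GN _ _))).
Qed.

Theorem mainTheorem6 (C : MonoidalCategory) (M N : Actegory C)
    (S : Monad M) (T : Monad N) (lS : DistrLaw S) (lT : DistrLaw T)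
    (K : Functor M N) (zetaK : Colax K) (alpha : MonadMap T S K) :
  (forall (Q : C) (X : M),
    fmap (act_functor N Q) (alpha X) ∘ lT Q (K X) ∘ fmap T (zetaK Q X)
    = zetaK Q (S X) ∘ fmap K (lS Q X) ∘ alpha (act_functor M Q X)) ->
  forall Q : C,
    exists sigma : NatTrans (functor_comp (EM_map alpha) (EM_lift lS Q))
                            (functor_comp (EM_lift lT Q) (EM_map alpha)),
      forall X : EM S, underlying (sigma X) = zetaK Q (carrier X).
Proof.
  intros compat Q.
  pose (component := fun X : Module S =>
    @Build_ModuleMap _ T (EM_map_ob alpha (EM_lift_ob lS Q X))
      (EM_lift_ob lT Q (EM_map_ob alpha X)) (zetaK Q (carrier X))
      (colax_linear C M N S T lS lT K zetaK alpha Q X (compat Q (carrier X)))).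
  unshelve eexists.
  - refine (@Build_NatTrans _ _
      (functor_comp (EM_map alpha) (EM_lift lS Q))
      (functor_comp (EM_lift lT Q) (EM_map alpha)) component _).
    intros X Y f; apply module_map_eq.
    exact (colax_natural zetaK (idm Q) (underlying f)).
  - reflexivity.
Qed.
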